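(* Let $(V,\top)$ be a locality vector space, $(A,\top_A)$ a locality algebra and $f:V\to A$ a locality linear map. Assume that for every $n\in\mathbb{N}$ the subspace $I^n_{\rm mult}(V)\cap F^n(V)\subset F^n(V)$ is locality compatible with $\top^n_\times$. Then there is a unique locality algebra morphism $\phi:(\mathcal{T}_\top(V),\top_\otimes)\to(A,\top_A)$ such that $f=\phi\circ\otimes_\top$, where $\otimes_\top:V\to\mathcal{T}_\top(V)$ is the canonical (locality) injection map.
   Context: $\mathbb{K}$ is $\mathbb{R}$ or $\mathbb{C}$. A locality vector space is a vector space $V$ with a symmetric relation $\top\subset V\times V$ containing $(0,0)$ such that for every $U\subset V$ the polar set $U^\top=\{x: x\top u\ \forall u\in U\}$ is a linear subspace. A locality linear map is a linear map sending related pairs to related pairs. A subspace $W$ of a locality vector space $(V,\top)$ is locality compatible with $\top$ if for all $(x,y,z)\in V^3$ and $w\in W$ with $x\top y$ and $(x+w)\top z$, there is $w'\in W$ with $(x+w')\top y$ and $(x+w')\top z$. $\mathbb{K}(X)$ is the free vector space on $X$. Tensor algebra: for $k\ge1$, $V^{\times_\top k}=\{(x_1,\dots,x_k)\in V^k: x_i\top x_j\ \forall i\ne j\}$; $I_{{\rm mult},k}(V)\subset\mathbb{K}(V^k)$ is spanned by all $(\dots,a_i+b_i,\dots)-(\dots,a_i,\dots)-(\dots,b_i,\dots)$ and $(\dots,cx_i,\dots)-c(\dots,x_i,\dots)$, $c\in\mathbb{K}$. $V^{\otimes_\top k}=\mathbb{K}(V^{\times_\top k})/(I_{{\rm mult},k}(V)\cap\mathbb{K}(V^{\times_\top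 k}))$, $V^{\otimes_\top 0}=\mathbb{K}$, $\mathcal{T}_\top(V)=\bigoplus_{k\ge0}V^{\otimes_\top k}$. Set $F^n(V)=\mathbb{K}\cdot1\oplus\bigoplus_{k=1}^n\mathbb{K}(V^{\times_\top k})$ and $I^n_{\rm mult}(V)=\bigoplus_{k=1}^nI_{{\rm mult},k}(V)$. Tuples $(x_i)$, $(y_j)$ are $\top^n_\times$-related iff $x_i\top y_j$ for all $i,j$; $1$ is related to every basis element; two elements of $F^n(V)$ are related iff all basis elements with nonzero coefficient in the first are related to all those in the second. Two elements of $\mathcal{T}_\top(V)$ are $\top_\otimes$-related iff for some $n$ they have $\top_\times^n$-related representatives in $F^n(V)$. The product on $\mathcal{T}_\top(V)$ is the tensor product restricted to $\top_\otimes$, with unit $\mathbb{K}=V^{\otimes_\top0}$. A locality algebra $(A,\top,m,u)$ is a locality vector space with a product $m:A\times_\top A:=\top\to A$ which is $\top_\times$-bilinear (its linear extension to $\mathbb{K}(\top)$ vanishes on $I_{{\rm mult},2}(A)\cap\mathbb{K}(\top)$), such that $m(m(x,y),z)=m(x,m(y,z))$ for pairwise independent $x,y,z$ whenever both sides are defined, $m((U^\top\times U^\top)\cap\top)\subset U^\top$ for every $U\subset A$, and a linear unit $u:\mathbb{K}\to A$ with $u(\mathbb{K})\subset A^\top$ and $m(u(c),a)=ca=m(a,u(c))$. A locality algebra morphism is a locality linear map $g$ with $g(m_1(x,y))=m_2(g(x),g(y))$ for all $x\top_1y$, preserving units. *)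

(* Defs.v *)
From HB Require Import structures.
From mathcomp Require Import all_boot all_algebra generic_quotient ring_quotient.
From mathcomp Require Import boolp classical_sets reals complex.
From mathcomp Require Import freeg.

Set Implicit Arguments.
Unset Strict Implicit.
Unset Printing Implicit Defensive.

Import GRing.Theory.

Local Open Scope ring_scope.
Local Open Scope classical_set_scope.
Local Open Scope quotient_scope.

Definition real_or_complex_field (K : fieldType) : Prop :=
  exists R : realType, K = R :> fieldType \/ K = R[i] :> fieldType.

Section Subspaces.
Context (K : fieldType) (M : lmodType K).

Definition linear_subspace (W : set M) : Prop := submod_closed [in W].

Definition span (G : set M) : set M := smallest linear_subspace G.

Definition sum_subspaces (D : set nat) (E : nat -> set M) : set M :=
  span (\bigcup_(k in D) E k).

Lemma linear_subspaceP (W : set M) :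
  linear_subspace W <-> W 0 /\ (forall c x y, W x -> W y -> W (c *: x + y)).
Proof.
split=> [[W0 WD]|[W0 WD]]; split.
- by move: W0; rewrite !inE.
- move=> c x y Wx Wy; have := WD c x y.
  by rewrite !inE; apply.
- by rewrite inE.
- by move=> c x y; rewrite !inE; apply: WD.
Qed.

Lemma span_subspace (G : set M) : linear_subspace (span G).
Proof.
apply/linear_subspaceP; split=> [W [/linear_subspaceP[]]//|c x y xG yG W WG].
have [/linear_subspaceP[_ WD] _] := WG.
by apply: WD; [exact: xG | exact: yG].
Qed.

End Subspaces.

(* The quotient of M by a linear subspace W, as a K-vector space; the library  *)
(* Quotient.quot only carries the additive structure.                         *)
Section QuotientSpace.
Context (K : fieldType) (M : lmodType K) (W : set M).
Context (W_sub : linear_subspace W).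

Definition in_subspace of linear_subspace W : {pred M} := [in W].

HB.instance Definition _ :=
  GRing.isSubmodClosed.Build K M (in_subspace W_sub)
  (GRing.submod_closed_semi W_sub).

Definition quot_space := Quotient.quot (in_subspace W_sub).

HB.instance Definition _ := GRing.Zmodule.on quot_space.
HB.instance Definition _ := Quotient.on quot_space.

Definition quot_scale (c : K) (x : quot_space) : quot_space :=
  \pi_quot_space (c *: repr x).

Lemma quot_eqP (x y : M) :
  \pi_quot_space x = \pi_quot_space y <-> x - y \in in_subspace W_sub.
Proof.
split=> [/eqP|xy].
  by rewrite -(Quotient.idealrBE (in_subspace W_sub)).
by apply/eqP; rewrite -(Quotient.idealrBE (in_subspace W_sub)).
Qed.

Lemma pi_quotD (x y : M) :
  \pi_quot_space (x + y) = \pi_quot_space x + \pi_quot_space y.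
Proof. by rewrite (Quotient.pi_add (in_subspace W_sub) x y). Qed.

Lemma pi_quotZ c (x : M) : \pi_quot_space (c *: x) = quot_scale c (\pi x).
Proof.
apply/quot_eqP; rewrite -scalerBr rpredZ //.
by apply/quot_eqP; rewrite reprK.
Qed.

Lemma quot_scaleA a b x : quot_scale a (quot_scale b x) = quot_scale (a * b) x.
Proof. by elim/quotW: x => x; rewrite -(pi_quotZ b) -!pi_quotZ scalerA. Qed.

Lemma quot_scale1 x : quot_scale 1 x = x.
Proof. by elim/quotW: x => x; rewrite -pi_quotZ scale1r. Qed.

Lemma quot_scaleDr a x y :
  quot_scale a (x + y) = quot_scale a x + quot_scale a y.
Proof.
elim/quotW: x => x; elim/quotW: y => y.
by rewrite -pi_quotD -!pi_quotZ -pi_quotD scalerDr.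
Qed.

Lemma quot_scaleDl x a b :
  quot_scale (a + b) x = quot_scale a x + quot_scale b x.
Proof. by elim/quotW: x => x; rewrite -!pi_quotZ -pi_quotD scalerDl. Qed.

HB.instance Definition _ := GRing.Zmodule_isLmodule.Build K quot_space
  quot_scaleA quot_scale1 quot_scaleDr quot_scaleDl.

End QuotientSpace.

Section LocalitySpaces.
Variable K : fieldType.

Definition polar (V : lmodType K) (top : V -> V -> Prop) (U : set V) : set V :=
  [set x | forall u, U u -> top x u].

Record locality_space (V : lmodType K) (top : V -> V -> Prop) : Prop := {
  locality_sym : forall x y, top x y -> top y x;
  locality_00 : top 0 0;
  locality_polar : forall U : set V, linear_subspace (polar top U) }.

Definition locality_linear (V W : lmodType K) (topV : V -> V -> Prop)
    (topW : W -> W -> Prop) (f : V -> W) : Prop :=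
  linear f /\ forall x y, topV x y -> topW (f x) (f y).

Definition locality_compatible (V : lmodType K) (top : V -> V -> Prop)
    (W : set V) : Prop :=
  forall x y z w, W w -> top x y -> top (x + w) z ->
    exists2 w', W w' & top (x + w') y /\ top (x + w') z.

End LocalitySpaces.

(* A tuple in V^k is encoded as a word of length k over V, so that             *)
(* {freeg (seq V) / K} is the direct sum over k >= 0 of the K(V^k), the empty  *)
(* word being the basis element 1 of the summand K.                            *)
Section Words.
Context (K : fieldType) (V : lmodType K) (top : V -> V -> Prop).

Local Notation FW := {freeg (seq V) / K}.

Definition locality_word (w : seq V) : Prop :=
  forall i j, (i < size w)%N -> (j < size w)%N -> i <> j -> top w`_i w`_j.

Definition mult_relators (k : nat) : set FW :=
  [set r | (exists s t a b, (size s + size t).+1 = k /\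
              r = << s ++ (a + b) :: t >> - << s ++ a :: t >>
                  - << s ++ b :: t >>)
        \/ (exists s t c x, (size s + size t).+1 = k /\
              r = << s ++ (c *: x) :: t >> - c *: << s ++ x :: t >>)].

Definition Imult (k : nat) : set FW := span (mult_relators k).

(* The span of the locality words whose length lies in P: K(V^{x_top k}) for   *)
(* P = pred1 k, F^n(V) for P = [pred k | k <= n], and the direct sum of all    *)
(* the K(V^{x_top k}) for P = predT.                                           *)
Definition locality_span (P : pred nat) : set FW :=
  [set p | forall w, coeff w p != 0 -> P (size w) /\ locality_word w].

Definition in_locality_span (P : pred nat) : {pred FW} :=
  [in locality_span P].

Lemma locality_span_submod P : submod_closed (in_locality_span P).
Proof.
apply/linear_subspaceP; split=> [w|c x y xP yP w]; first by rewrite coeff0 eqxx.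
rewrite coeffD coeffZ; have [x0|/xP//] := eqVneq (coeff w x) 0.
by rewrite x0 mulr0 add0r => /yP.
Qed.

HB.instance Definition _ P := GRing.isSubmodClosed.Build K FW
  (in_locality_span P)
  (GRing.submod_closed_semi (locality_span_submod P)).

Record locality_free (P : pred nat) := LocalityFree {
  locality_free_val :> FW;
  _ : locality_free_val \in in_locality_span P }.

HB.instance Definition _ P := [isSub for @locality_free_val P].
HB.instance Definition _ P := [Choice of locality_free P by <:].
HB.instance Definition _ P :=
  [SubChoice_isSubLmodule of locality_free P by <:].

Definition word_rel (s t : seq V) : Prop :=
  forall x y, x \in s -> y \in t -> top x y.

Definition top_cross (P : pred nat) (p q : locality_free P) : Prop :=
  forall s t, coeff s (val p) != 0 -> coeff t (val q) != 0 -> word_rel s t.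

Definition Fn (n : nat) := locality_free [pred k | (k <= n)%N].
HB.instance Definition _ n := GRing.Lmodule.on (Fn n).

Definition top_crossn (n : nat) (p q : Fn n) : Prop := top_cross p q.

Definition Imult_le (n : nat) : set FW :=
  sum_subspaces [set k | (1 <= k <= n)%N] Imult.

Definition Imult_in_Fn (n : nat) : set (Fn n) := [set p | Imult_le n (val p)].

Definition Ftop := locality_free predT.
HB.instance Definition _ := GRing.Lmodule.on Ftop.

(* The direct sum over k >= 1 of the I_{mult,k}(V) \cap K(V^{x_top k}), seen   *)
(* inside the direct sum of the K(V^{x_top k}).                                *)
Definition tensor_ideal : set Ftop :=
  [set p | sum_subspaces [set k | (1 <= k)%N]
             (fun k => Imult k `&` locality_span (pred1 k)) (val p)].

Lemma tensor_ideal_subspace : linear_subspace tensor_ideal.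
Proof.
have /linear_subspaceP[S0 SD] := @span_subspace K FW
  (\bigcup_(k in [set k | (1 <= k)%N]) (Imult k `&` locality_span (pred1 k))).
by apply/linear_subspaceP; split=> [|c x y xI yI]; [exact: S0 | exact: SD].
Qed.

(* As quotients commute with direct sums, this is the direct sum of the        *)
(* K(V^{x_top k}) / (I_{mult,k}(V) \cap K(V^{x_top k})).                       *)
Definition tensor_alg := quot_space tensor_ideal_subspace.
HB.instance Definition _ := GRing.Lmodule.on tensor_alg.
HB.instance Definition _ := Quotient.on tensor_alg.

Lemma Fn_sub (n : nat) (p : Fn n) : val p \in in_locality_span predT.
Proof.
rewrite inE => w pw; split=> //.
by have := valP p; rewrite inE => /(_ w pw)[].
Qed.

Definition tensor_class (n : nat) (p : Fn n) : tensor_alg :=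
  \pi_tensor_alg (LocalityFree (Fn_sub p) : Ftop).

Definition top_tensor (x y : tensor_alg) : Prop :=
  exists n (p q : Fn n),
    [/\ tensor_class p = x, tensor_class q = y & top_crossn p q].

(* Bilinear extension of the concatenation of words. *)
Definition concat (p q : FW) : FW :=
  fglift (fun s => fglift (fun t => << s ++ t >> : FW) q) p.

(* All related representatives p, q give the same class, so xget selects the   *)
(* tensor product; its default value 0 is only used off the locality relation. *)
Definition tensor_mul (x y : tensor_alg) : tensor_alg :=
  xget 0 [set z | exists n (p q : Fn n) (r : Ftop),
    [/\ tensor_class p = x, tensor_class q = y, top_crossn p q,
        val r = concat (val p) (val q) & \pi_tensor_alg r = z]].

Lemma word_in_span (w : seq V) :
  locality_word w -> << w >> \in in_locality_span predT.
Proof.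
move=> hw; rewrite inE => w'; rewrite coeffU mul1r.
by have [<-|_] := eqVneq w w'; rewrite ?eqxx.
Qed.

Lemma locality_word0 : locality_word [::].
Proof. by []. Qed.

Lemma locality_word1 v : locality_word [:: v].
Proof. by move=> [|i] [|j]. Qed.

Definition tensor_unit (c : K) : tensor_alg :=
  \pi_tensor_alg (c *: (LocalityFree (word_in_span locality_word0) : Ftop)).

Definition tensor_in (v : V) : tensor_alg :=
  \pi_tensor_alg (LocalityFree (word_in_span (@locality_word1 v)) : Ftop).

End Words.

Arguments top_crossn {K V} top n p q.
Arguments Imult_in_Fn {K V} top n _.
Arguments top_tensor {K V} top x y.
Arguments tensor_mul {K V} top x y.
Arguments tensor_unit {K V} top c.
Arguments tensor_in {K V} top v.

(* The partial product A x_top A -> A of a locality algebra is encoded by a    *)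
(* total function, whose values on unrelated pairs are never constrained.      *)
Section LocalityAlgebras.
Context (K : fieldType).

(* The words of length 2 in locality_span are the elements of A x_top A, and   *)
(* fglift is the linear extension of the product.                              *)
Definition top_bilinear (A : lmodType K) (top : A -> A -> Prop)
    (m : A -> A -> A) : Prop :=
  forall p, p \in in_locality_span top (pred1 2) -> Imult 2 p ->
    fglift (fun w => m w`_0 w`_1) p = 0.

Record locality_algebra (A : lmodType K) (top : A -> A -> Prop)
    (m : A -> A -> A) (u : K -> A) : Prop := {
  lalg_space : locality_space top;
  lalg_bilinear : top_bilinear top m;
  lalg_assoc : forall x y z, top x y -> top x z -> top y z ->
    top (m x y) z -> top x (m y z) -> m (m x y) z = m x (m y z);
  lalg_polar : forall (U : set A) x y,
    polar top U x -> polar top U y -> top x y -> polar top U (m x y);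
  lalg_unit_linear : linear (u : K^o -> A);
  lalg_unit_polar : forall c, polar top setT (u c);
  lalg_unitl : forall c a, m (u c) a = c *: a;
  lalg_unitr : forall c a, m a (u c) = c *: a }.

Record locality_algebra_morphism (A B : lmodType K)
    (topA : A -> A -> Prop) (mA : A -> A -> A) (uA : K -> A)
    (topB : B -> B -> Prop) (mB : B -> B -> B) (uB : K -> B)
    (g : A -> B) : Prop := {
  lalg_mor_linear : locality_linear topA topB g;
  lalg_mor_mul : forall x y, topA x y -> g (mA x y) = mB (g x) (g y);
  lalg_mor_unit : forall c, g (uA c) = uB c }.

End LocalityAlgebras.

(* Main.v *)
From HB Require Import structures.
From mathcomp Require Import all_boot all_algebra generic_quotient.
From mathcomp Require Import boolp classical_sets.
From mathcomp Require Import freeg.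
From mathcomp Require Import zify.
Require Import Defs.

(** Let J be the sum of all the ideals I_{mult,k}(V) in the free vector space
    on words over V, so that the quotient by J is the ordinary tensor algebra
    T(V). As J is homogeneous, two combinations of locality words have the
    same class in T_top(V) exactly when they differ by an element of J
    [tensor_idealE]. Hence T_top(V) embeds linearly into T(V), and on related
    pairs the partial product is the restriction of the total, bilinear and
    associative product of T(V) [embed_mul]. This gives bilinearity and
    associativity of the partial product.

    Locality compatibility enters where one class has two representatives that
    are adapted to two different elements: they can be replaced by a single
    representative adapted to both [common_representative]. This makes polars
    linear subspaces, and it lets three pairwise related classes be represented
    by three pairwise related elements [related_triple], which is what makes
    polars stable under products.

    The morphism must send a locality word v1 ... vk to the product
    f(v1)(f(v2)(... f(vk))), since such a word is the product of its letters;
    this gives uniqueness. For existence, the linear extension of this formula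
    to combinations of locality words has to vanish on I_{mult,k}(V)
    [eval_lin_Imult]. The difficulty is that an element of I_{mult,k}(V) may be
    a combination of locality words although the multilinearity relations of
    which it is a sum involve words on which the product in A has no meaning.
    The proof is an induction on k. By induction the evaluation of words of
    length k is a well defined linear map on a subspace of the k-th tensor
    power of V; over a field it extends to a linear map h on the whole power
    [linear_extension]. Then v w |-> (f(v), h(w)) carries the relations of
    length k+1 over V to relations of length 2 over A, without any locality
    condition, and it carries locality words to related pairs. So the
    bilinearity of the product of A applies to the image and yields 0.
    The evaluation map is multiplicative by associativity in A, and all the
    products that occur are defined because polars in A are stable under
    products. *)

Set Implicit Arguments.
Unset Strict Implicit.
Unset Printing Implicit Defensive.

Import GRing.Theory.

Local Open Scope ring_scope.
Local Open Scope classical_set_scope.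
Local Open Scope quotient_scope.

(** * Linear algebra *)

Section Subspace.
Context (K : fieldType) (M : lmodType K) (W : set M) (hW : linear_subspace W).

Lemma subspace0 : W 0.
Proof. by have /linear_subspaceP[] := hW. Qed.

Lemma subspaceP c x y : W x -> W y -> W (c *: x + y).
Proof. by have /linear_subspaceP[_] := hW; apply. Qed.

Lemma subspaceZ c x : W x -> W (c *: x).
Proof. by move=> Wx; rewrite -[_ *: _]addr0; apply: subspaceP subspace0. Qed.

Lemma subspaceD x y : W x -> W y -> W (x + y).
Proof. by move=> Wx Wy; rewrite -[x]scale1r; apply: subspaceP. Qed.

Lemma subspaceN x : W x -> W (- x).
Proof. by rewrite -scaleN1r; apply: subspaceZ. Qed.

Lemma subspaceB x y : W x -> W y -> W (x - y).
Proof. by move=> Wx Wy; apply: subspaceD => //; apply: subspaceN. Qed.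

Lemma subspace_sum (I : eqType) (r : seq I) (P : pred I) (F : I -> M) :
  (forall i, i \in r -> P i -> W (F i)) -> W (\sum_(i <- r | P i) F i).
Proof.
move=> WF; rewrite big_seq_cond; apply: big_ind => [|x y|i /andP[]].
- exact: subspace0.
- exact: subspaceD.
- exact: WF.
Qed.

End Subspace.

Section LinearAlgebra.
Context (K : fieldType) (M N : lmodType K).

Lemma span_gen (G : set M) : G `<=` span G.
Proof. exact: sub_gen_smallest. Qed.

Lemma span_min (G W : set M) : linear_subspace W -> G `<=` W -> span G `<=` W.
Proof. exact: smallest_sub. Qed.

Lemma span_mono (G H : set M) : G `<=` H -> span G `<=` span H.
Proof.
move=> GH; apply: span_min; first exact: span_subspace.
exact: subset_trans GH (@span_gen H).
Qed.

Lemma span_preim (h : {linear M -> N}) (G : set M) (W : set N) x :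
  span G x -> linear_subspace W -> (forall y, G y -> W (h y)) -> W (h x).
Proof.
move=> Gx /linear_subspaceP[W0 WD] GW; apply: (@span_min G (W \o h)) Gx => //.
apply/linear_subspaceP; split=> [|c y z Wy Wz] /=; first by rewrite linear0.
by rewrite linearP; apply: WD.
Qed.

Lemma span_ker (h : {linear M -> N}) (G : set M) x :
  span G x -> (forall y, G y -> h y = 0) -> h x = 0.
Proof.
move=> Gx; apply: (@span_preim h G [set 0]) => //; apply/linear_subspaceP.
by split=> // c y z -> ->; rewrite scaler0 addr0.
Qed.

(** Every linear map defined on a subspace extends to the whole space. The
    partial map is given by its graph [G], and Zorn's lemma yields a maximal
    graph containing it. *)
Lemma linear_extension (G : set (M * N)) :
    linear_subspace G -> (forall y, G (0, y) -> y = 0) ->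
  exists h : {linear M -> N}, forall x y, G (x, y) -> h x = y.
Proof.
move=> Gsub G1.
pose good (X : set (M * N)) :=
  linear_subspace X /\ forall y, X (0, y) -> y = 0.
(* Taking the union with G in the predicate makes the empty chain harmless. *)
have [F FP totF|H [[Hsub H1] Hmax]] :=
    @Zorn_bigcup _ [set H | good (G `|` H)].
  have two x y : (G `|` \bigcup_(X in F) X) x -> (G `|` \bigcup_(X in F) X) y ->
      exists2 H, good (G `|` H) & [/\ H `<=` \bigcup_(X in F) X,
        (G `|` H) x & (G `|` H) y].
    move=> [Gx|[X FX Xx]] [Gy|[Y FY Yy]].
    - exists set0; first by rewrite setU0.
      by split; [exact: sub0set | left | left].
    - exists Y; first exact: FP.
      by split; [exact: bigcup_sup | left | right].
    - exists X; first exact: FP.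
      by split; [exact: bigcup_sup | right | left].
    - have [XY|YX] := totF _ _ FX FY.
        exists Y; first exact: FP.
        by split; [exact: bigcup_sup | right; exact: XY | right].
      exists X; first exact: FP.
      by split; [exact: bigcup_sup | right | right; exact: YX].
  split=> [|y Gy].
    apply/linear_subspaceP; split=> [|c x y Gx Gy].
      by left; exact: subspace0 Gsub.
    have [H [Hsub _] [HF Hx Hy]] := two _ _ Gx Gy.
    by apply: setUS HF _ _; apply: subspaceP Hsub _ _ _ Hx Hy.
  by have [H [_ H1] [_ /H1]] := two _ _ Gy Gy.
set X := G `|` H in Hsub H1.
have Xmax Y : good Y -> X `<=` Y -> Y `<=` X.
  move=> Ygood XY; apply: contrapT => nYX; apply: (Hmax Y).

    split=> [x Hx|]; first by apply: XY; right.
    by apply: contra_not nYX => YH x /YH; right.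
  suff /= -> : G `|` Y = Y by [].
  by apply/setUidPr => x Gx; apply: XY; left.
(* If m is outside the domain of the maximal graph X, then X + K (m, 0) is a
   larger graph. *)
have /choice[h Xh] : forall m, exists n, X (m, n).
  move=> m; apply: contrapT => noX.
  pose Y : set (M * N) := [set z | exists c, X (z.1 - c *: m, z.2)].
  have : good Y.
    split=> [|y [c /=]].
      apply/linear_subspaceP; split=> [|c [x1 x2] [y1 y2] [a /= Xx] [b /= Xy]].
        by exists 0; rewrite /= scale0r subr0; exact: subspace0 Hsub.
      exists (c * a + b) => /=; have := subspaceP Hsub c Xx Xy.
      congr (X (_, _)); rewrite /= scalerBr scalerA scalerDl opprD.
      by rewrite addrACA.
    have [->|c0] := eqVneq c 0; first by rewrite scale0r subr0; exact: H1.
    move=> /(subspaceZ Hsub (- c^-1)) Xm; case: noX; exists (- c^-1 *: y).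
    move: Xm; congr (X (_, _)).
    by rewrite /= sub0r scaleNr scalerN opprK scalerK.
  move=> /Xmax/(_ _ (m, 0))[[x y] Xxy||Gm|Hm].
  - by exists 0; rewrite scale0r subr0.
  - by exists 1; rewrite /= scale1r subrr; exact: subspace0 Hsub.
  - by apply: noX; exists 0; left.
  - by apply: noX; exists 0; right.
have X1 x y y' : X (x, y) -> X (x, y') -> y = y'.
  move=> Xy Xy'; apply/eqP; rewrite -subr_eq0; apply/eqP/H1.
  by have := subspaceB Hsub Xy Xy'; congr (X (_, _)); rewrite /= subrr.
have hlin : linear h.
  move=> c x y; apply: X1 (Xh _) _.
  exact: subspaceP Hsub _ _ _ (Xh x) (Xh y).
pose H' := GRing.isLinear.Build K M N *:%R h hlin.
pose h' : {linear M -> N} := HB.pack h H'.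
by exists h' => x y Gxy; apply: X1 (Xh x) _; left.
Qed.

(** A linear map on [D] that kills the intersection with [J] descends to the
    image of [D] in the quotient by [J], from where it extends. *)
Lemma linear_extension_vanishing (D J : set M) (g : {linear M -> N}) :
    linear_subspace D -> linear_subspace J ->
    (forall x, D x -> J x -> g x = 0) ->
  exists h : {linear M -> N},
    (forall x, D x -> h x = g x) /\ (forall x, J x -> h x = 0).
Proof.
move=> Dsub Jsub gDJ.
pose G : set (M * N) := [set z | exists2 d, D d & J (z.1 - d) /\ z.2 = g d].
have [||h hG] := @linear_extension G.
- apply/linear_subspaceP; split=> [|c [x1 x2] [y1 y2]].
    exists 0; first exact: subspace0 Dsub.
    by split; rewrite /= ?subr0 ?linear0 //; exact: subspace0 Jsub.
  move=> [d Dd /= [Jx ->]] [e De /= [Jy ->]]; exists (c *: d + e).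
    exact: subspaceP.
  split; last by rewrite linearP.
  have := subspaceP Jsub c Jx Jy; congr (J _).
  by rewrite /= scalerBr opprD addrACA.
- move=> y [d Dd /= [Jd ->]]; apply: gDJ => //.
  by rewrite -[d]opprK; apply: subspaceN => //; rewrite -sub0r.
exists h; split=> x Wx; apply: hG.
  by exists x => //=; rewrite subrr; split=> //; exact: subspace0 Jsub.
exists 0; first exact: subspace0 Dsub.
by rewrite /= subr0 linear0.
Qed.

End LinearAlgebra.

(** * Free vector spaces *)

Section FreeModule.
Context (K : fieldType) (T : choiceType).
Implicit Types (M : lmodType K) (p : {freeg T / K}).

Lemma freegUZ (k : K) (x : T) : << k *g x >> = k *: << x >>.
Proof. by apply/eqP/freeg_eqP => y; rewrite coeffZ !coeffU mul1r. Qed.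

Lemma freegE p : p = \sum_(x <- dom p) coeff x p *: << x >>.
Proof. by rewrite -[LHS]freeg_sumE; apply: eq_bigr => x _; rewrite freegUZ. Qed.

Section Lift.
Context (M : lmodType K) (g : T -> M).

Lemma fglift_linear : linear (fglift g).
Proof.
pose L : {additive {freeg T / K} -> M} := HB.pack (fglift g)
  (GRing.isZmodMorphism.Build _ _ (fglift g) (lift_is_additive g)).
have fD p q : fglift g (p + q) = fglift g p + fglift g q := raddfD L p q.
have f0 : fglift g 0 = 0 := raddf0 L.
move=> c p q; rewrite fD; congr (_ + _).
elim/freeg_ind_dom0: p => [|k x p _ _ IHp].
  by rewrite scaler0 f0 scaler0.
rewrite scalerDr freegUZ scalerA !fD IHp.
by rewrite -!freegUZ /= !liftU scalerDr scalerA.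
Qed.

HB.instance Definition _ :=
  GRing.isLinear.Build K {freeg T / K} M *:%R (fglift g) fglift_linear.

Lemma fglift_word x : fglift g << x >> = g x.
Proof. by rewrite liftU scale1r. Qed.

End Lift.

Lemma linear_freegE M (h : {linear {freeg T / K} -> M}) p :
  h p = \sum_(x <- dom p) coeff x p *: h << x >>.
Proof.
by rewrite {1}[p]freegE linear_sum; apply: eq_bigr => x _; rewrite linearZ.
Qed.

Lemma linear_freeg_ext M (h1 h2 : {linear {freeg T / K} -> M}) p :
  (forall x, coeff x p != 0 -> h1 << x >> = h2 << x >>) -> h1 p = h2 p.
Proof.
move=> h12; rewrite linear_freegE [RHS]linear_freegE.
by apply: eq_big_seq => x; rewrite mem_dom => /h12 ->.
Qed.

Lemma fgliftE M (g : T -> M) p :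
  fglift g p = \sum_(x <- dom p) coeff x p *: g x.
Proof.
by rewrite linear_freegE; apply: eq_bigr => x _; rewrite /= fglift_word.
Qed.

End FreeModule.

(** * The ordinary tensor algebra *)

Section Quotient.
Context (K : fieldType) (M : lmodType K) (W : set M).
Context (W_sub : linear_subspace W).

Definition quot_proj (x : M) : quot_space W_sub := \pi_(quot_space W_sub) x.

Lemma quot_proj_linear : linear quot_proj.
Proof. by move=> c x y; rewrite /quot_proj pi_quotD pi_quotZ. Qed.

HB.instance Definition _ := GRing.isLinear.Build K M (quot_space W_sub) *:%R
  quot_proj quot_proj_linear.

Lemma quot_projP x y : quot_proj x = quot_proj y <-> W (x - y).
Proof.
by split=> [/quot_eqP|Wxy]; [|apply/quot_eqP]; rewrite /in_subspace inE.
Qed.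

Lemma quot_proj_surj (x : quot_space W_sub) : exists p, quot_proj p = x.
Proof. by exists (repr x); rewrite /quot_proj reprK. Qed.

End Quotient.

Section TensorAlgebra.
Context (K : fieldType) (V : lmodType K).

Local Notation FW := {freeg (seq V) / K}.

Implicit Types (p q r : FW) (s t w : seq V) (k n : nat).

Definition component k : FW -> FW :=
  fglift (fun w => if size w == k then << w >> else 0).

HB.instance Definition _ k := GRing.Linear.on (component k).

Lemma component_word k w :
  component k << w >> = if size w == k then << w >> else 0.
Proof. exact: fglift_word. Qed.

Lemma coeff_component k p w :
  coeff w (component k p) = if size w == k then coeff w p else 0.
Proof.
elim/freeg_ind_dom0: p => [|c x p _ _ IHp].
  by rewrite linear0 coeff0 if_same.
rewrite freegUZ linearP/= !coeffD !coeffZ IHp component_word coeffU mul1r.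
have [<-|xw] := eqVneq x w.
  by case: ifP => _; rewrite ?coeffU ?eqxx ?coeff0 ?mul1r // mulr0 addr0.
by case: ifP; rewrite ?coeffU ?(negPf xw) ?coeff0 mulr0 ?mulr0 !add0r.
Qed.

Lemma sum_component n p :
  (forall w, coeff w p != 0 -> (size w <= n)%N) ->
  \sum_(k < n.+1) component k p = p.
Proof.
move=> pn; apply/eqP/freeg_eqP => w; rewrite raddf_sum.
under eq_bigr do rewrite /= coeff_component.
have [wp|/pn] := eqVneq (coeff w p) 0.
  by rewrite wp big1 // => k _; rewrite if_same.
by rewrite -ltnS => wn; rewrite -big_mkcond (big_pred1 (Ordinal wn)).
Qed.

Lemma component_relator j k p :
  mult_relators j p -> component k p = if j == k then p else 0.
Proof.
by case=> [[s [t [a [b [sz ->]]]]]|[s [t [c [x [sz ->]]]]]];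
  rewrite !(linearB, linearZ) /= !component_word !size_cat /= !addnS sz;
  case: eqP => // _; rewrite oppr0 ?scaler0 !addr0.
Qed.

Lemma component_Imult j k p :
  Imult j p -> component k p = if j == k then p else 0.
Proof.
move=> jp; pose L : {linear FW -> FW} :=
  component k \- (j == k)%:R \*: (@idfun FW).
suff : L p = 0.
  move/eqP; rewrite subr_eq0 => /eqP -> /=.
  by case: eqP; rewrite ?scale1r ?scale0r.
apply: (span_ker jp) => q qr; rewrite /L /= (component_relator k qr).
by case: eqP => _; rewrite ?scale1r ?scale0r subrr.
Qed.

Lemma Imult0 p : Imult 0 p -> p = 0.
Proof.
by move=> /(span_ker (h := idfun)); apply=> r [] [? [? [? [?]]]] [].
Qed.

Definition mult_ideal : set FW := sum_subspaces setT (@Imult K V).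

Lemma mult_ideal_subspace : linear_subspace mult_ideal.
Proof. exact: span_subspace. Qed.

Lemma Imult_ideal k : Imult k `<=` mult_ideal.
Proof. by move=> p kp; apply: span_gen; exists k. Qed.

(** [mult_ideal] is homogeneous. *)
Lemma component_ideal k p : mult_ideal p -> Imult k (component k p).
Proof.
move=> /span_preim; apply; first exact: span_subspace.
move=> q [j _ jq]; rewrite /= (component_Imult _ jq).
by have [<-//|_] := eqVneq; apply: subspace0; exact: span_subspace.
Qed.

(** The ordinary tensor algebra of [V]. *)
Definition tens := quot_space mult_ideal_subspace.
HB.instance Definition _ := GRing.Lmodule.on tens.

Definition tens_proj : FW -> tens := quot_proj mult_ideal_subspace.
HB.instance Definition _ := GRing.Linear.on tens_proj.

Lemma tens_projP p q : tens_proj p = tens_proj q <-> mult_ideal (p - q).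
Proof. exact: quot_projP. Qed.

Lemma tens_proj_surj (x : tens) : exists p, tens_proj p = x.
Proof. exact: quot_proj_surj. Qed.

(** [concat] with its arguments exchanged, so that linearity in the first
    argument can be inferred as well. *)
Definition concatr q p : FW := concat p q.

HB.instance Definition _ q := GRing.Linear.copy (concatr q) (fglift _).

Lemma concat_linearr p : linear (concat p).
Proof.
move=> c q r; rewrite /concat !fgliftE scaler_sumr -big_split /=.
apply: eq_bigr => s _; rewrite linearP scalerDr !scalerA.
by rewrite [_ * c]mulrC.
Qed.

HB.instance Definition _ p :=
  GRing.isLinear.Build K FW FW *:%R (concat p) (concat_linearr p).

Lemma concat_word s t : concat << s >> << t >> = << s ++ t >> :> FW.
Proof. by rewrite /concat !fglift_word. Qed.

Lemma concatE p q : concat p q =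
  \sum_(s <- dom p) \sum_(t <- dom q) (coeff s p * coeff t q) *: << s ++ t >>.
Proof.
rewrite /concat fgliftE; apply: eq_bigr => s _.
by rewrite fgliftE scaler_sumr; apply: eq_bigr => t _; rewrite scalerA.
Qed.

Lemma concat0p p : concat << [::] >> p = p.
Proof. by rewrite /concat fglift_word [RHS]freegE fgliftE. Qed.

Lemma concatp0 p : concat p << [::] >> = p.
Proof.
rewrite [RHS]freegE /concat fgliftE; apply: eq_bigr => s _.
by rewrite fglift_word cats0.
Qed.

Lemma concatA p q r : concat (concat p q) r = concat p (concat q r).
Proof.
pose L1 : {linear FW -> FW} := concatr r \o concatr q.
pose L2 : {linear FW -> FW} := concatr (concat q r).
apply: (@linear_freeg_ext _ _ _ L1 L2) => s _; rewrite /L1 /L2 /concatr /=.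
pose L3 : {linear FW -> FW} := concatr r \o concat << s >>.
pose L4 : {linear FW -> FW} := concat << s >> \o concatr r.
apply: (@linear_freeg_ext _ _ _ L3 L4) => t _; rewrite /L3 /L4 /concatr /=.
pose L5 : {linear FW -> FW} := concat << s >> \o concat << t >>.
apply: (@linear_freeg_ext _ _ _ (concat (concat << s >> << t >>)) L5) => w _.
by rewrite /L5 /= !concat_word catA.
Qed.

Lemma relator_ideal k p : mult_relators k p -> mult_ideal p.
Proof. by move=> kp; apply: (@Imult_ideal k); apply: span_gen. Qed.

Lemma mult_ideal_ind (M : lmodType K) (h : {linear FW -> M}) (W : set M) :
  linear_subspace W -> (forall k r, mult_relators k r -> W (h r)) ->
  forall p, mult_ideal p -> W (h p).
Proof.
move=> Wsub Wr p /span_preim; apply=> // q [k _ /span_preim]; apply=> //.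
exact: Wr.
Qed.

(** Concatenating words on either side of a multilinearity relation only moves
    the slot where the relation takes place. *)
Lemma concat_ideal_word s t k r : mult_relators k r ->
  mult_ideal (concat << s >> (concat r << t >>)).
Proof.
move=> kr; apply: (@relator_ideal (size s + k + size t)).
case: kr => [[s' [t' [a [b [sz ->]]]]]|[s' [t' [c [x [sz ->]]]]]].
  left; exists (s ++ s'), (t' ++ t), a, b; split.
    by rewrite !size_cat -sz !addnS !addSn !addnA.
  rewrite -![concat _ << t >>]/(concatr _ _) !linearB /= /concatr.
  by rewrite !concat_word -!catA.
right; exists (s ++ s'), (t' ++ t), c, x; split.
  by rewrite !size_cat -sz !addnS !addSn !addnA.
rewrite -![concat _ << t >>]/(concatr _ _) !(linearB, linearZ) /= /concatr.
by rewrite !concat_word -!catA.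
Qed.

Lemma concat_ideal_l p q : mult_ideal p -> mult_ideal (concat p q).
Proof.
have Jsub := mult_ideal_subspace.
apply: (@mult_ideal_ind _ (concatr q)) => // k r kr; rewrite /= /concatr.
rewrite linear_freegE; apply: (subspace_sum Jsub) => t _ _.
apply: (subspaceZ Jsub).
by rewrite /= -[concat r _]concat0p; exact: (concat_ideal_word _ _ kr).
Qed.

Lemma concat_ideal_r p q : mult_ideal q -> mult_ideal (concat p q).
Proof.
have Jsub := mult_ideal_subspace.
apply: (@mult_ideal_ind _ (concat p)) => // k r kr.
rewrite /= -[concat p r]/(concatr r p) linear_freegE.
apply: (subspace_sum Jsub) => s _ _.
apply: (subspaceZ Jsub); rewrite /= /concatr.
by rewrite -[r in concat _ r]concatp0; exact: (concat_ideal_word _ _ kr).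
Qed.

Definition tens_mul (x y : tens) : tens := tens_proj (concat (repr x) (repr y)).

Lemma tens_mul_proj p q :
  tens_mul (tens_proj p) (tens_proj q) = tens_proj (concat p q).
Proof.
have projK r : mult_ideal (repr (tens_proj r) - r).
  by apply/tens_projP; rewrite /tens_proj /quot_proj reprK.
apply/tens_projP; rewrite -(subrKA (concat p (repr (tens_proj q)))).
apply: subspaceD mult_ideal_subspace _ _ _ _.
  rewrite -![concat _ (repr _)]/(concatr _ _) -linearB.
  exact: concat_ideal_l.
by rewrite -linearB; apply: concat_ideal_r.
Qed.

Lemma tens_mulA : associative tens_mul.
Proof.
move=> x y z; have [p <-] := tens_proj_surj x; have [q <-] := tens_proj_surj y.
by have [r <-] := tens_proj_surj z; rewrite !tens_mul_proj concatA.
Qed.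

Lemma tens_mul_linearl y : linear (tens_mul ^~ y).
Proof.
move=> c x z; have [p <-] := tens_proj_surj x; have [q <-] := tens_proj_surj y.
have [r <-] := tens_proj_surj z; rewrite -linearP !tens_mul_proj -linearP.
by congr tens_proj; rewrite -![concat _ q]/(concatr q _) linearP.
Qed.

Lemma tens_mul_linearr x : linear (tens_mul x).
Proof.
move=> c y z; have [p <-] := tens_proj_surj x; have [q <-] := tens_proj_surj y.
have [r <-] := tens_proj_surj z; rewrite -linearP !tens_mul_proj -linearP.
by congr tens_proj; rewrite linearP.
Qed.

End TensorAlgebra.

Section Bilinear.
Context (K : fieldType) (M N : lmodType K).

Lemma bilinear_Imult2 (B : M -> M -> N) (p : {freeg (seq M) / K}) :
    (forall y, linear (B ^~ y)) -> (forall x, linear (B x)) ->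
  Imult 2 p -> fglift (fun w => B w`_0 w`_1) p = 0.
Proof.
move=> Bl Br p2; apply: (span_ker (h := fglift _) p2) => r.
have Bl1 x x' y : B (x + x') y = B x y + B x' y.
  by have := Bl y 1 x x'; rewrite !scale1r.
have Br1 x y y' : B x (y + y') = B x y + B x y'.
  by have := Br x 1 y y'; rewrite !scale1r.
have Bl0 y : B 0 y = 0 by apply/(addrI (B 0 y)); rewrite -Bl1 !addr0.
have Br0 x : B x 0 = 0 by apply/(addrI (B x 0)); rewrite -Br1 !addr0.
have BlZ c x y : B (c *: x) y = c *: B x y.
  by have := Bl y c x 0; rewrite Bl0 !addr0.
have BrZ c x y : B x (c *: y) = c *: B x y.
  by have := Br x c y 0; rewrite Br0 !addr0.
case=> [[[|x [|? ?]] [[|y [|? ?]] [a [b [// _ ->]]]]]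
      |[[|x [|? ?]] [[|y [|? ?]] [c [a [// _ ->]]]]]];
  rewrite !(linearB, linearZ) /= !fglift_word /=.
- by rewrite Bl1 -addrA -opprD subrr.
- by rewrite Br1 -addrA -opprD subrr.
- by rewrite BlZ scalerN subrr.
- by rewrite BrZ scalerN subrr.
Qed.

End Bilinear.

(** * The locality tensor algebra *)

Section LocalityTensorAlgebra.
Context (K : fieldType) (V : lmodType K) (top : V -> V -> Prop).

Local Notation FW := {freeg (seq V) / K}.
Local Notation F := (Ftop top).

Implicit Types (p q r : F) (x y z : tensor_alg top) (s t w : seq V).

Lemma locality_spanP P (p : locality_free top P) w :
  coeff w (val p) != 0 -> P (size w) /\ locality_word top w.
Proof. by have := valP p; rewrite inE => /(_ w). Qed.

Lemma locality_wordP P (p : locality_free top P) w :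
  coeff w (val p) != 0 -> locality_word top w.
Proof. by case/locality_spanP. Qed.

(** A priori [tensor_ideal] is generated degree by degree by combinations of
    locality words. The homogeneous components of an element of [mult_ideal]
    that is a combination of locality words lie in [mult_ideal] and are again
    combinations of locality words, hence are such generators. *)
Lemma tensor_idealE p : tensor_ideal p <-> mult_ideal (val p).
Proof.
split=> [|Jp]; first by apply: span_mono => q [k _ [kq _]]; exists k.
have [n pn] : exists n, forall w, coeff w (val p) != 0 -> (size w <= n)%N.
  exists (\max_(w <- dom (val p)) size w) => w; rewrite -mem_dom => wp.
  exact: leq_bigmax_seq.
rewrite /tensor_ideal /= -(sum_component pn).
apply: (subspace_sum (span_subspace _)) => -[[|k] /= _] _ _.
  rewrite (Imult0 (component_ideal Jp)); exact: subspace0 (span_subspace _).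
apply: span_gen; exists k.+1 => //; split; first exact: component_ideal.
move=> w; rewrite coeff_component; case: ifP => [wk /locality_wordP//|_].
by rewrite eqxx.
Qed.

Lemma Imult_in_FnE n (p : Fn top n) :
  Imult_in_Fn top n p <-> mult_ideal (val p).
Proof.
split=> [|Jp]; first by apply: span_mono => q [k _ kq]; exists k.
have pn w : coeff w (val p) != 0 -> (size w <= n)%N by case/locality_spanP.
rewrite /Imult_in_Fn /= -(sum_component pn).
apply: (subspace_sum (span_subspace _)) => -[[|k] /= kn] _ _.
  rewrite (Imult0 (component_ideal Jp)); exact: subspace0 (span_subspace _).
by apply: span_gen; exists k.+1 => //; exact: component_ideal.
Qed.

Definition tclass : F -> tensor_alg top :=
  quot_proj (tensor_ideal_subspace top).
HB.instance Definition _ := GRing.Linear.on tclass.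

Lemma tclassP p q : tclass p = tclass q <-> mult_ideal (val p - val q).
Proof.
rewrite -[val p - val q]/(val (p - q)) -tensor_idealE; exact: quot_projP.
Qed.

Lemma tclass_surj x : exists p, tclass p = x.
Proof. exact: quot_proj_surj. Qed.

Lemma tensor_classE n (p : Fn top n) q :
  val p = val q -> tensor_class p = tclass q.
Proof. by move=> pq; congr tclass; apply: val_inj. Qed.

Lemma Ftop_of_Fn n (p : Fn top n) : exists q : F, val q = val p.
Proof. by exists (LocalityFree (Fn_sub p)). Qed.

Lemma Fn_of_Ftop p :
  exists n, forall m, (n <= m)%N -> exists q : Fn top m, val q = val p.
Proof.
exists (\max_(w <- dom (val p)) size w) => m nm.
suff pm : val p \in in_locality_span top [pred k | (k <= m)%N].
  by exists (LocalityFree pm).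
rewrite inE => w wp; split; last exact: locality_wordP wp.
by apply: leq_trans nm; apply: leq_bigmax_seq; rewrite // mem_dom.
Qed.

Lemma top_cross_val P Q (p q : locality_free top P)
    (p' q' : locality_free top Q) :
  val p = val p' -> val q = val q' -> top_cross p q -> top_cross p' q'.
Proof. by rewrite /top_cross => -> ->. Qed.

(** The length bound [n] in [top_tensor] can be forgotten, because every
    combination of words has a bounded length. *)
Lemma top_tensorP x y : top_tensor top x y <->
  exists p q, [/\ tclass p = x, tclass q = y & top_cross p q].
Proof.
split=> [[n [p [q [<- <- pq]]]]|[p [q [<- <- pq]]]].
  have [p' pE] := Ftop_of_Fn p; have [q' qE] := Ftop_of_Fn q.
  exists p', q'; split; [exact/esym/tensor_classE|exact/esym/tensor_classE|].
  exact: top_cross_val pq.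
have [n pn] := Fn_of_Ftop p; have [m qm] := Fn_of_Ftop q.
have [p' pE] := pn _ (leq_maxl n m); have [q' qE] := qm _ (leq_maxr n m).
exists (maxn n m), p', q'; split; [exact: tensor_classE|exact: tensor_classE|].
exact: top_cross_val pq.
Qed.

(** The inclusion of the locality tensor algebra in the ordinary one. *)
Definition embed x : tens V := tens_proj (val (repr x)).

Lemma embed_class p : embed (tclass p) = tens_proj (val p).
Proof. by apply/tens_projP/tclassP; rewrite /tclass /quot_proj reprK. Qed.

Lemma embed_inj : injective embed.
Proof.
move=> x y; have [p <-] := tclass_surj x; have [q <-] := tclass_surj y.
by rewrite !embed_class => /tens_projP/tclassP.
Qed.

Lemma embed_linear : linear embed.
Proof.
move=> c x y; have [p <-] := tclass_surj x; have [q <-] := tclass_surj y.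
by rewrite -linearP !embed_class -linearP.
Qed.

HB.instance Definition _ :=
  GRing.isLinear.Build K (tensor_alg top) (tens V) *:%R embed embed_linear.

Section Locality.
Context (hV : locality_space top).

Lemma top_cross_sym p q : top_cross p q -> top_cross q p.
Proof.
by move=> pq s t sq tp v w vs wt; apply: (locality_sym hV); apply: pq wt vs.
Qed.

Lemma top_crossP c p q r :
  top_cross p r -> top_cross q r -> top_cross (c *: p + q) r.
Proof.
move=> pr qr s t; rewrite coeffD coeffZ => sp tr.
have [p0|] := eqVneq (coeff s (val p)) 0; last by move=> /pr; apply.
by apply: qr tr; move: sp; rewrite p0 mulr0 add0r.
Qed.

Lemma locality_word_cat s t : locality_word top s -> locality_word top t ->
  word_rel top s t -> locality_word top (s ++ t).
Proof.
move=> sl tl st i j; rewrite size_cat !nth_cat => ilt jlt ij.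
case: ltnP => si; case: ltnP => sj.
- exact: sl.
- by apply: st; apply: mem_nth => //; rewrite ltn_subLR.
- by apply/(locality_sym hV)/st; apply: mem_nth => //; rewrite ltn_subLR.
- apply: tl; rewrite ?ltn_subLR // => /eqP; rewrite eqn_sub2rE // => /eqP.
  exact: ij.
Qed.

Lemma coeff_concat w (p q : FW) : coeff w (concat p q) != 0 ->
  exists s t, [/\ w = s ++ t, coeff s p != 0 & coeff t q != 0].
Proof.
apply: contraNP => nst; rewrite concatE raddf_sum big1_seq // => s /andP[_].
rewrite mem_dom => sp; rewrite raddf_sum big1_seq // => t /andP[_].
rewrite mem_dom => tq; rewrite /= coeffZ coeffU mul1r.
have [wE|_] := eqVneq; last by rewrite mulr0.
by case: nst; exists s, t.
Qed.

Lemma concat_Ftop p q :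
  top_cross p q -> exists r, val r = concat (val p) (val q).
Proof.
move=> pq; suff rF : concat (val p) (val q) \in in_locality_span top predT.
  by exists (LocalityFree rF).
rewrite inE => w /coeff_concat[s [t [-> sp tq]]]; split=> //.
apply: locality_word_cat; [exact: locality_wordP sp|exact: locality_wordP tq|].
exact: pq.
Qed.

(** The class of the concatenation of related representatives does not depend
    on their choice, as it can be computed in the ordinary tensor algebra. *)
Lemma tensor_mul_class p q r : top_cross p q ->
  val r = concat (val p) (val q) ->
  tensor_mul top (tclass p) (tclass q) = tclass r.
Proof.
move=> pq rE; have [n pn] := Fn_of_Ftop p; have [m qm] := Fn_of_Ftop q.
have [p' pE] := pn _ (leq_maxl n m); have [q' qE] := qm _ (leq_maxr n m).
apply: xget_unique => [|z].
  exists (maxn n m), p', q', r.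
  split; rewrite ?pE ?qE //; try exact: tensor_classE.
  exact: top_cross_val pq.
case=> k [p1 [q1 [r1 [p1E q1E _ r1E <-]]]]; rewrite -[LHS]/(tclass r1).
apply/tclassP/tens_projP; rewrite rE r1E -!tens_mul_proj.
have [p2 p2E] := Ftop_of_Fn p1; have [q2 q2E] := Ftop_of_Fn q1.
rewrite -p2E -q2E -!embed_class -p1E -q1E.
by rewrite (tensor_classE (esym p2E)) (tensor_classE (esym q2E)).
Qed.

Lemma embed_mul x y : top_tensor top x y ->
  embed (tensor_mul top x y) = tens_mul (embed x) (embed y).
Proof.
move=> /top_tensorP[p [q [<- <- pq]]]; have [r rE] := concat_Ftop pq.
by rewrite (tensor_mul_class pq rE) !embed_class tens_mul_proj rE.
Qed.

Section Compatible.
Context (hcompat : forall n : nat,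
  locality_compatible (top_crossn top n) (Imult_in_Fn top n)).

(** All the elements involved live in a common [Fn top n], where compatibility
    corrects [p] by a relation [W] without losing that it is related to [q]. *)
Lemma common_representative p p' q r : tclass p = tclass p' ->
  top_cross p q -> top_cross p' r ->
  exists s : F, [/\ tclass s = tclass p, top_cross s q & top_cross s r].
Proof.
move=> /tclassP pp' pq p'r.
have [n1 /(_ _ _)h1] := Fn_of_Ftop p; have [n2 h2] := Fn_of_Ftop p'.
have [n3 h3] := Fn_of_Ftop q; have [n4 h4] := Fn_of_Ftop r.
pose n := (n1 + n2 + n3 + n4)%N.
have [|P PE] := h1 n; first by rewrite /n; lia.
have [|P' PE'] := h2 n; first by rewrite /n; lia.
have [|Q QE] := h3 n; first by rewrite /n; lia.
have [|R RE] := h4 n; first by rewrite /n; lia.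
have [|||W JW [PQ PR]] := hcompat (x := P) (y := Q) (z := R) (w := P' - P).
- apply/Imult_in_FnE; rewrite /= PE PE' -opprB.
  by apply: subspaceN pp'; exact: mult_ideal_subspace.
- exact: top_cross_val pq.
- by rewrite addrC subrK; exact: top_cross_val p'r.
have [s sE] := Ftop_of_Fn (P + W); exists s; split.
- apply/tclassP; rewrite sE /= PE addrAC subrr add0r; exact/Imult_in_FnE.
- exact: top_cross_val PQ.
- exact: top_cross_val PR.
Qed.

(** Each of the three classes has two representatives, one for each of the
    relations in which it takes part. They are merged one class after the
    other; each merge keeps the relations obtained so far. *)
Lemma related_triple x y z :
    top_tensor top x y -> top_tensor top x z -> top_tensor top y z ->
  exists p q r, [/\ tclass p = x, tclass q = y, tclass r = z &
    [/\ top_cross p q, top_cross p r & top_cross q r]].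
Proof.
move=> /top_tensorP[p [q [px qy pq]]] /top_tensorP[p' [r [px' rz pr]]].
move=> /top_tensorP[q' [r' [qy' rz' qr]]].
have [|p1 [p1E p1q p1r]] := common_representative _ pq pr; first by rewrite px.
have [|q1 [q1E q1p q1r]] := common_representative _ (top_cross_sym p1q) qr.
  by rewrite qy.
have [|r1 [r1E r1p r1q]] :=
  common_representative _ (top_cross_sym p1r) (top_cross_sym q1r).
  by rewrite rz.
exists p1, q1, r1; rewrite p1E q1E r1E; split=> //.
by split; apply: top_cross_sym.
Qed.

Lemma tensor_locality_space : locality_space (top_tensor top).
Proof.
split.
- move=> x y /top_tensorP[p [q [px qy pq]]].
  by apply/top_tensorP; exists q, p; split=> //; apply: top_cross_sym.
- apply/top_tensorP; exists 0, 0; split; rewrite ?linear0 // => s t.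
  by rewrite coeff0 eqxx.
- move=> U; apply/linear_subspaceP; split=> [u _|c x y xU yU u Uu].
    have [q <-] := tclass_surj u; apply/top_tensorP; exists 0, q.
    by split; rewrite ?linear0 // => s t; rewrite coeff0 eqxx.
  have /top_tensorP[p [r [<- ru pr]]] := xU _ Uu.
  have /top_tensorP[q [r' [<- ru' qr]]] := yU _ Uu.
  have [|s [sr sp sq]] :=
    common_representative _ (top_cross_sym pr) (top_cross_sym qr).
    by rewrite ru.
  apply/top_tensorP; exists (c *: p + q), s; rewrite linearP sr.
  by split=> //; apply: top_crossP; apply: top_cross_sym.
Qed.

Lemma top_cross_concat p q r (s : F) : val s = concat (val p) (val q) ->
  top_cross p r -> top_cross q r -> top_cross s r.
Proof.
move=> sE pr qr w t; rewrite sE => /coeff_concat[w1 [w2 [-> pw1 qw2]]] rt v1 v2.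
rewrite mem_cat => /orP[v1w|v1w] v2t; first exact: pr pw1 rt _ _ v1w v2t.
exact: qr qw2 rt _ _ v1w v2t.
Qed.

(** With pairwise related representatives [p], [q], [r], the concatenation of
    [p] and [q] is a representative of the product that is related to [r]. *)
Lemma tensor_polar (U : set (tensor_alg top)) x y :
    polar (top_tensor top) U x -> polar (top_tensor top) U y ->
  top_tensor top x y -> polar (top_tensor top) U (tensor_mul top x y).
Proof.
move=> xU yU xy u Uu.
have [p [q [r [<- <- <- [pq pr qr]]]]] := related_triple xy (xU u Uu) (yU u Uu).
have [s sE] := concat_Ftop pq; rewrite (tensor_mul_class pq sE).
apply/top_tensorP; exists s, r; split=> //; exact: top_cross_concat sE pr qr.
Qed.

(** On words of related pairs the partial product is the restriction of a
    bilinear map, which vanishes on all bilinearity relations. *)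
Lemma tensor_bilinear : top_bilinear (top_tensor top) (tensor_mul top).
Proof.
move=> p; rewrite inE => pF p2; apply: embed_inj; rewrite linear0.
pose m := fun w : seq (tensor_alg top) => tensor_mul top w`_0 w`_1.
pose m' := fun w : seq (tensor_alg top) => tens_mul (embed w`_0) (embed w`_1).
rewrite -[LHS]/((embed \o fglift m) p).
rewrite (@linear_freeg_ext _ _ _ (embed \o fglift m) (fglift m')).
  apply: (bilinear_Imult2 (B := fun x y => tens_mul (embed x) (embed y))) p2.
    by move=> y c x z; rewrite linearP tens_mul_linearl.
  by move=> y c x z; rewrite linearP tens_mul_linearr.
move=> w /pF[/eqP sz wl]; rewrite /= !fglift_word; apply: embed_mul => //.
by apply: wl; rewrite ?sz.
Qed.

Lemma tensor_assoc x y z :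
    top_tensor top x y -> top_tensor top y z ->
    top_tensor top (tensor_mul top x y) z ->
    top_tensor top x (tensor_mul top y z) ->
  tensor_mul top (tensor_mul top x y) z = tensor_mul top x (tensor_mul top y z).
Proof.
by move=> xy yz xy_z x_yz; apply: embed_inj; rewrite !embed_mul // tens_mulA.
Qed.

Definition empty_word : F := LocalityFree (word_in_span (locality_word0 top)).

Lemma tensor_unitE c : tensor_unit top c = tclass (c *: empty_word).
Proof. by []. Qed.

Lemma top_cross_unit c p : top_cross (c *: empty_word) p.
Proof.
move=> s t; rewrite coeffZ coeffU mul1r.
by have [<-|_] := eqVneq [::] s; rewrite ?mulr0 ?eqxx.
Qed.

Lemma tensor_unit_mul c x : tensor_mul top (tensor_unit top c) x = c *: x.
Proof.
have [p <-] := tclass_surj x; rewrite tensor_unitE.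
rewrite (tensor_mul_class (r := c *: p) (@top_cross_unit c p)) ?linearZ //=.
by rewrite -[RHS]/(concatr _ _) linearZ /= /concatr concat0p.
Qed.

Lemma tensor_mul_unit c x : tensor_mul top x (tensor_unit top c) = c *: x.
Proof.
have [p <-] := tclass_surj x; rewrite tensor_unitE.
rewrite (tensor_mul_class (r := c *: p) (top_cross_sym (@top_cross_unit c p)));
  first by rewrite linearZ.
by rewrite /= linearZ /= concatp0.
Qed.

Theorem tensor_locality_algebra :
  locality_algebra (top_tensor top) (tensor_mul top) (tensor_unit top).
Proof.
split.
- exact: tensor_locality_space.
- exact: tensor_bilinear.
- by move=> x y z xy _ yz; apply: tensor_assoc.
- exact: tensor_polar.
- by move=> c a b; rewrite !tensor_unitE -linearP scalerDl scalerA.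
- move=> c x _; have [p <-] := tclass_surj x; rewrite tensor_unitE.
  apply/top_tensorP; exists (c *: empty_word), p; split=> //.
  exact: top_cross_unit.
- exact: tensor_unit_mul.
- exact: tensor_mul_unit.
Qed.

End Compatible.
End Locality.
End LocalityTensorAlgebra.

(** * Multilinearity in a locality algebra *)

Section LocalityAlgebraTheory.
Context (K : fieldType) (A : lmodType K) (topA : A -> A -> Prop).
Context (mA : A -> A -> A) (uA : K -> A) (hA : locality_algebra topA mA uA).

Let hAs := lalg_space hA.

Lemma word2_span (x y : A) :
  topA x y -> << [:: x; y] >> \in in_locality_span topA (pred1 2).
Proof.
move=> xy; rewrite inE => w; rewrite coeffU mul1r.
have [<- _|_] := eqVneq [:: x; y] w; last by rewrite eqxx.
by split=> // -[|[|i]] [|[|j]] //= _ _ _; exact: (locality_sym hAs).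
Qed.

Lemma polar_linear (U : set A) c x y : polar topA U x -> polar topA U y ->
  polar topA U (c *: x + y).
Proof. by apply: subspaceP; exact: locality_polar hAs U. Qed.

Lemma polar_zero (U : set A) : polar topA U 0.
Proof. by apply: subspace0; exact: locality_polar hAs U. Qed.

Lemma polar_sum (U : set A) (I : eqType) (r : seq I) (a : I -> K) (F : I -> A) :
  (forall i, i \in r -> polar topA U (F i)) ->
  polar topA U (\sum_(i <- r) a i *: F i).
Proof.
move=> FU; have Usub := locality_polar hAs U.
by apply: (subspace_sum Usub) => i ir _; apply: subspaceZ Usub _ _ (FU i ir).
Qed.

(** Linearity of the product in one slot is the bilinearity axiom for a sum of
    two relations of length 2. Letting [s] and [t] be arbitrary words of total
    length 1 treats both slots at once. *)
Lemma lalg_mul_slot s t c x y : (size s + size t)%N = 1 ->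
    (forall z, z \in [:: x; y; c *: x; c *: x + y] ->
      << s ++ z :: t >> \in in_locality_span topA (pred1 2)) ->
  let m := fun w : seq A => mA w`_0 w`_1 in
  m (s ++ (c *: x + y) :: t) = c *: m (s ++ x :: t) + m (s ++ y :: t).
Proof.
move=> sz wF m; pose r1 : {freeg (seq A) / K} := << s ++ (c *: x + y) :: t >>
  - << s ++ (c *: x) :: t >> - << s ++ y :: t >>.
pose r2 : {freeg (seq A) / K} := << s ++ (c *: x) :: t >>
  - c *: << s ++ x :: t >>.
have rI : Imult 2 (r1 + r2).
  apply: (subspaceD (span_subspace _)); apply: span_gen.
    by left; exists s, t, (c *: x), y; rewrite sz.
  by right; exists s, t, c, x; rewrite sz.
have rF : r1 + r2 \in in_locality_span topA (pred1 2).
  by rewrite !(rpredD, rpredN, rpredZ) //; apply: wF; rewrite !inE eqxx ?orbT.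
have := lalg_bilinear hA rF rI.
rewrite !linearD !linearN linearZ /= !fglift_word -/m.
rewrite addrACA subrK [- _ - _]addrC -opprD => /eqP.
by rewrite subr_eq0 => /eqP.
Qed.

Lemma lalg_mul_linearl c x y z : topA x z -> topA y z ->
  mA (c *: x + y) z = c *: mA x z + mA y z.
Proof.
move=> xz yz; apply: (@lalg_mul_slot [::] [:: z]) => // v vin.
apply: word2_span; apply: (_ : polar topA [set z] v) => //.
have xP : polar topA [set z] x by move=> _ ->.
have yP : polar topA [set z] y by move=> _ ->.
move: vin; rewrite !inE => /or4P[] /eqP -> //; last exact: polar_linear.
by rewrite -[_ *: _]addr0; apply: polar_linear xP _; exact: polar_zero.
Qed.

Lemma lalg_mul_linearr c x y z : topA x z -> topA y z ->
  mA z (c *: x + y) = c *: mA z x + mA z y.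
Proof.
move=> xz yz; apply: (@lalg_mul_slot [:: z] [::]) => // v vin.
apply: word2_span; apply: (locality_sym hAs).
apply: (_ : polar topA [set z] v) => //.
have xP : polar topA [set z] x by move=> _ ->.
have yP : polar topA [set z] y by move=> _ ->.
move: vin; rewrite !inE => /or4P[] /eqP -> //; last exact: polar_linear.
by rewrite -[_ *: _]addr0; apply: polar_linear xP _; exact: polar_zero.
Qed.

Lemma polar_linear_sum (g : A -> A) z :
    (forall c x y, topA x z -> topA y z -> g (c *: x + y) = c *: g x + g y) ->
  forall (I : eqType) (r : seq I) (a : I -> K) (F : I -> A),
    (forall i, i \in r -> topA (F i) z) ->
  g (\sum_(i <- r) a i *: F i) = \sum_(i <- r) a i *: g (F i).
Proof.
move=> glin I r a F; elim: r => [_|i r IHr Fz].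
  have zz : topA 0 z by apply: (@polar_zero [set z]).
  rewrite !big_nil; apply: (addrI (g 0)).
  by have := glin 1 _ _ zz zz; rewrite !scale1r !addr0.
have Fr j : j \in r -> topA (F j) z.
  by move=> jr; apply: Fz; rewrite inE jr orbT.
rewrite !big_cons glin ?IHr //; first by apply: Fz; rewrite mem_head.
by apply: (@polar_sum [set z]) => // j /Fr ? _ ->.
Qed.

Definition lalg_mul_suml z := polar_linear_sum
  (fun c x y => @lalg_mul_linearl c x y z).

Definition lalg_mul_sumr z := polar_linear_sum
  (fun c x y => @lalg_mul_linearr c x y z).

End LocalityAlgebraTheory.

(** * The universal property *)

Section UniversalProperty.
Context (K : fieldType) (V : lmodType K) (top : V -> V -> Prop).
Context (hV : locality_space top).
Context (A : lmodType K) (topA : A -> A -> Prop).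
Context (mA : A -> A -> A) (uA : K -> A) (hA : locality_algebra topA mA uA).
Context (f : V -> A) (hf : locality_linear top topA f).

Local Notation FW := {freeg (seq V) / K}.
Local Notation F := (Ftop top).

Implicit Types (p q : F) (s t w : seq V).

Let symA := locality_sym (lalg_space hA).

Let f_top x y : top x y -> topA (f x) (f y).
Proof. by case: hf => _; apply. Qed.

Let fL : {linear V -> A} :=
  HB.pack f (GRing.isLinear.Build _ _ _ _ f (proj1 hf)).

Let fD a b : f (a + b) = f a + f b := linearD fL a b.

Let fZ c a : f (c *: a) = c *: f a := linearZZ fL c a.

Lemma locality_word_cons v w : locality_word top (v :: w) ->
  (forall x, x \in w -> top v x) /\ locality_word top w.
Proof.
move=> vw; split=> [x /(nthP 0)[i iw <-]|i j iw jw ij].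
  exact: (vw 0 i.+1).
by apply: (vw i.+1 j.+1) => // -[].
Qed.

Definition eval : seq V -> A := foldr (fun v a => mA (f v) a) (uA 1).

(** Stated for all [U], because the induction step needs it at the singleton of
    the image of the first letter, to see that the next product is defined. *)
Lemma eval_polar (U : set A) w : locality_word top w ->
  (forall v, v \in w -> polar topA U (f v)) -> polar topA U (eval w).
Proof.
elim: w U => [|v w IHw] U vw Uvw.
  by move=> x _; exact: (lalg_unit_polar hA).
have [vx wl] := locality_word_cons vw.
apply: (lalg_polar hA) => [||].
- by apply: Uvw; rewrite mem_head.
- by apply: IHw => // x xw; apply: Uvw; rewrite inE xw orbT.
- apply: (symA); apply: (IHw [set f v]) => // x /vx/f_top/symA vx' _ -> //.
Qed.

Lemma top_eval v w : (forall x, x \in w -> topA (f x) v) ->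
  locality_word top w -> topA v (eval w).
Proof.
by move=> wv wl; apply: (symA); apply: (@eval_polar [set v]) => // x /wv ? _ ->.
Qed.

Lemma eval_top s t : locality_word top s -> locality_word top t ->
  word_rel top s t -> topA (eval s) (eval t).
Proof.
move=> sl tl st; apply: (symA); apply: top_eval => // x xs.
by apply: top_eval => // y yt; apply/symA/f_top/st.
Qed.

Lemma eval_cat s t : locality_word top s -> locality_word top t ->
  word_rel top s t -> eval (s ++ t) = mA (eval s) (eval t).
Proof.
move=> + tl; elim: s => [|v s IHs] vs st /=.
  by rewrite (lalg_unitl hA) scale1r.
have [vx sl] := locality_word_cons vs.
have st' : word_rel top s t by move=> x y xs; apply: st; rewrite inE xs orbT.
have v_s : topA (f v) (eval s).
  by apply: top_eval => // x /vx/f_top/symA.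
have v_t : topA (f v) (eval t).
  by apply: top_eval => // x xt; apply/symA/f_top/st; rewrite ?mem_head.
have s_t := eval_top sl tl st'; rewrite IHs //.
rewrite (lalg_assoc hA) //.
  by apply: (lalg_polar hA (U := [set eval t])) => // _ ->.
by apply: (symA); apply: (lalg_polar hA (U := [set f v])) => // [_ ->|_ ->];
  apply: (symA).
Qed.

Definition eval_lin : FW -> A := fglift eval.
HB.instance Definition _ := GRing.Linear.on eval_lin.

Lemma eval_lin_word w : eval_lin << w >> = eval w.
Proof. exact: fglift_word. Qed.

Lemma eval_linE (p : FW) :
  eval_lin p = \sum_(w <- dom p) coeff w p *: eval w.
Proof. exact: fgliftE. Qed.

Lemma eval_lin_top_word s q : locality_word top s ->
    (forall t, coeff t (val q) != 0 -> word_rel top s t) ->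
  topA (eval s) (eval_lin (val q)).
Proof.
move=> sl sq; apply: (symA); rewrite eval_linE.
apply: (polar_sum hA (U := [set eval s])) => // t; rewrite mem_dom => tq _ ->.
apply/symA/eval_top => //; [exact: locality_wordP tq | exact: sq].
Qed.

Lemma eval_lin_top p q :
  top_cross p q -> topA (eval_lin (val p)) (eval_lin (val q)).
Proof.
move=> pq; rewrite (eval_linE (val p)).
apply: (polar_sum hA (U := [set eval_lin (val q)])) => // s.
rewrite mem_dom => sp _ ->; apply: eval_lin_top_word.
  exact: locality_wordP sp.
by move=> t; apply: pq.
Qed.

Lemma eval_lin_concat p q : top_cross p q ->
  eval_lin (concat (val p) (val q)) = mA (eval_lin (val p)) (eval_lin (val q)).
Proof.
move=> pq; rewrite concatE linear_sum (eval_linE (val p)).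
rewrite (lalg_mul_suml hA) => [|s]; last first.
  rewrite mem_dom => sp; apply: eval_lin_top_word.
    exact: locality_wordP sp.
  by move=> t; apply: pq.
apply: eq_big_seq => s; rewrite mem_dom => sp.
have sl := locality_wordP sp.
rewrite linear_sum eval_linE (lalg_mul_sumr hA) => [|t]; last first.
  rewrite mem_dom => tq; apply/symA/eval_top => //; last exact: pq.
  exact: locality_wordP tq.
rewrite scaler_sumr; apply: eq_big_seq => t; rewrite mem_dom => tq.
rewrite linearZ /= eval_lin_word -scalerA eval_cat //; last exact: pq.
exact: locality_wordP tq.
Qed.

(** The evaluation of words is compatible with multilinearity even though the
    relations adding up to [p] may leave the locality words. Extending the
    evaluation of shorter words to a linear map [h] on all words removes the
    locality condition from everything but the last product, for which the
    bilinearity axiom of [A] is available. *)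
Lemma eval_lin_Imult n (p : FW) :
  p \in in_locality_span top (pred1 n) -> Imult n p -> eval_lin p = 0.
Proof.
elim: n p => [|n IHn] p pF pI; first by rewrite (Imult0 pI) linear0.
have [||w|h [hF hI]] := @linear_extension_vanishing _ _ _
    (locality_span top (pred1 n)) (@Imult K V n) eval_lin.
- exact: locality_span_submod.
- exact: span_subspace.
- by move=> wF wI; apply: IHn => //; rewrite inE.
pose theta : {linear FW -> {freeg (seq A) / K}} := fglift (fun w =>
  if w is v :: w' then << [:: f v; h << w' >>] >> else 0).
have thetaE v w : theta << v :: w >> = << [:: f v; h << w >>] >>.
  exact: fglift_word.
(* A relation in the first letter stays one by linearity of f. For a relation
   in the remaining letters, h satisfies that relation, so that its image is
   a relation in the second slot. *)
have thetaI : Imult 2 (theta p).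
  apply: (span_preim pI); first exact: span_subspace.
  move=> _ [[s [t [a [b [+ ->]]]]]|[s [t [c [a [+ ->]]]]]];
    case: s => [|v s] /= [sz]; rewrite !(linearB, linearZ) /= !thetaE.
  - apply: span_gen; left; exists [::], [:: h << t >>], (f a), (f b).
    by rewrite fD.
  - have -> : h << s ++ (a + b) :: t >> =
        h << s ++ a :: t >> + h << s ++ b :: t >>.
      apply/eqP; rewrite -linearD -subr_eq0 -linearB opprD addrA.
      apply/eqP/hI; apply: span_gen.
      by left; exists s, t, a, b; rewrite -sz addSn.
    apply: span_gen; left.
    by exists [:: f v], [::], (h << s ++ a :: t >>), (h << s ++ b :: t >>).
  - apply: span_gen; right; exists [::], [:: h << t >>], c, (f a).
    by rewrite fZ scalerN.
  - have -> : h << s ++ c *: a :: t >> = c *: h << s ++ a :: t >>.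
      apply/eqP; rewrite -linearZ -subr_eq0 -linearB.
      apply/eqP/hI; apply: span_gen.
      by right; exists s, t, c, a; rewrite -sz addSn.
    rewrite scalerN; apply: span_gen; right.
    by exists [:: f v], [::], c, (h << s ++ a :: t >>).
have cons_word w : coeff w p != 0 -> exists v t, [/\ w = v :: t,
    locality_word top (v :: t) & h << t >> = eval t].
  move: pF; rewrite inE => pF /pF[]; case: w => // v t /= /eqP[sz] vt.
  exists v, t; split=> //; rewrite hF; first exact: eval_lin_word.
  move=> w.
  have [_ tl] := locality_word_cons vt.
  by rewrite coeffU mul1r; have [<-|_] := eqVneq t w; rewrite ?eqxx //= sz.
have thetaF : theta p \in in_locality_span topA (pred1 2).
  rewrite linear_freegE big_seq rpred_sum // => w.
  rewrite mem_dom => /cons_word[v [t [-> /locality_word_cons[vt tl] ht]]].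
  rewrite rpredZ // thetaE; apply: (word2_span hA); rewrite ht.
  by apply: top_eval => // x /vt/f_top/symA.
rewrite -(lalg_bilinear hA thetaF thetaI).
apply: (linear_freeg_ext (h1 := eval_lin) (h2 := fglift _ \o theta)) => w.
move=> /cons_word[v [t [-> _ ht]]].
by rewrite /= thetaE eval_lin_word fglift_word /= ht.
Qed.

(** A locality word as an element of [Ftop top]; totalized by 0 so that it can
    be extended linearly. *)
Definition word_elt w : F :=
  if pselect (locality_word top w) is left wl
  then LocalityFree (word_in_span wl) else 0.

Lemma val_word_elt w : locality_word top w -> val (word_elt w) = << w >>.
Proof. by rewrite /word_elt; case: pselect. Qed.

Lemma Ftop_sum p : fglift word_elt (val p) = p.
Proof.
apply: val_inj.
apply: (linear_freeg_ext (h1 := val \o fglift word_elt) (h2 := idfun)) => w wp.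
by rewrite /= fglift_word val_word_elt //; exact: locality_wordP wp.
Qed.

Definition tensor_lift (x : tensor_alg top) : A := eval_lin (val (repr x)).

Lemma tensor_lift_class p : tensor_lift (tclass p) = eval_lin (val p).
Proof.
apply/eqP; rewrite -subr_eq0 -linearB /=.
have : mult_ideal (val (repr (tclass p)) - val p).
  by apply/tclassP; rewrite /tclass /quot_proj reprK.
move=> /(tensor_idealE (repr (tclass p) - p)) /(span_ker (h := eval_lin)) -> //.
by move=> q [k _ [kI kF]]; apply: eval_lin_Imult kI; rewrite inE.
Qed.

Lemma tensor_lift_linear : linear tensor_lift.
Proof.
move=> c x y; have [p <-] := tclass_surj x; have [q <-] := tclass_surj y.
by rewrite -linearP !tensor_lift_class linearP.
Qed.

Lemma tensor_lift_morphism :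
  locality_algebra_morphism (top_tensor top) (tensor_mul top) (tensor_unit top)
    topA mA uA tensor_lift.
Proof.
split.
- split; first exact: tensor_lift_linear.
  move=> x y /top_tensorP[p [q [<- <- pq]]]; rewrite !tensor_lift_class.
  exact: eval_lin_top.
- move=> x y /top_tensorP[p [q [<- <- pq]]]; have [r rE] := concat_Ftop hV pq.
  by rewrite (tensor_mul_class pq rE) !tensor_lift_class rE eval_lin_concat.
- move=> c; rewrite tensor_unitE tensor_lift_class linearZ /= eval_lin_word /=.
  pose u : {linear K^o -> A} :=
    HB.pack (uA : K^o -> A) (GRing.isLinear.Build _ _ _ _ (uA : K^o -> A)
      (lalg_unit_linear hA)).
  by have := linearZZ u c 1; rewrite /= [_ *: 1]mulr1 => <-.
Qed.

Lemma tensor_lift_in v : tensor_lift (tensor_in top v) = f v.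
Proof.
rewrite -[tensor_in top v]/(tclass _) tensor_lift_class eval_lin_word /=.
by rewrite (lalg_unitr hA) scale1r.
Qed.

(** A nonempty locality word is the product of its first letter and of the
    remaining word, which are related; so a morphism is determined on words by
    its values on letters, and on all classes by linearity. *)
Lemma morphism_class (g : tensor_alg top -> A) p :
    locality_algebra_morphism (top_tensor top) (tensor_mul top)
      (tensor_unit top) topA mA uA g ->
    f = g \o tensor_in top ->
  g (tclass p) = eval_lin (val p).
Proof.
move=> [[glin gtop] gmul gunit] fE.
have gword w : locality_word top w -> g (tclass (word_elt w)) = eval w.
  elim: w => [|v w IHw] wl /=.
    rewrite -[uA 1]gunit tensor_unitE scale1r.
    by congr (g (tclass _)); apply: val_inj; rewrite val_word_elt.
  have [vx wl'] := locality_word_cons wl; rewrite -IHw // fE /=.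
  pose pv : F := LocalityFree (word_in_span (@locality_word1 _ _ top v)).
  have vw : top_cross pv (word_elt w).
    move=> s t; rewrite val_word_elt // !coeffU !mul1r.
    have [<- _|_] := eqVneq [:: v] s; last by rewrite eqxx.
    have [<- _|_] := eqVneq w t; last by rewrite eqxx.
    by move=> x y; rewrite inE => /eqP -> /vx.
  rewrite -[tensor_in top v]/(tclass pv) -gmul; last first.
    by apply/top_tensorP; exists pv, (word_elt w).
  congr g; apply/esym/(tensor_mul_class vw).
  by rewrite !val_word_elt // concat_word.
pose G : {linear tensor_alg top -> A} :=
  HB.pack g (GRing.isLinear.Build _ _ _ _ g glin).
rewrite -{1}[p]Ftop_sum.
rewrite -[LHS]/((G \o @tclass K V top \o fglift word_elt) (val p)).
apply: (linear_freeg_ext (h2 := eval_lin)) => w /locality_wordP wl.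
by rewrite /= fglift_word eval_lin_word gword.
Qed.

End UniversalProperty.

Theorem theorem7p5 (K : fieldType) (hK : real_or_complex_field K)
    (V : lmodType K) (top : V -> V -> Prop) (hV : locality_space top)
    (A : lmodType K) (topA : A -> A -> Prop) (mA : A -> A -> A) (uA : K -> A)
    (hA : locality_algebra topA mA uA)
    (f : V -> A) (hf : locality_linear top topA f)
    (hcompat : forall n : nat,
       locality_compatible (top_crossn top n) (Imult_in_Fn top n)) :
  locality_algebra (top_tensor top) (tensor_mul top) (tensor_unit top) /\
  exists! phi : tensor_alg top -> A,
    locality_algebra_morphism (top_tensor top) (tensor_mul top)
      (tensor_unit top) topA mA uA phi /\
    f = phi \o tensor_in top.
Proof.
split; first exact: tensor_locality_algebra.
exists (tensor_lift mA uA f); split.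
  split; first exact: tensor_lift_morphism.
  by apply/funext => v; rewrite /= (tensor_lift_in hA hf).
move=> g [gmor fE]; apply/funext => x; have [p <-] := tclass_surj x.
by rewrite (tensor_lift_class hA hf) (morphism_class p gmor fE).
Qed.
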